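(* Let $q\ge 3$ be an integer and let $0\le\beta<\beta_s(q)$. There exists a constant $\theta^*>0$, depending only on $\beta$ and $q$, such that for every integer $N\ge 1$ and every function $h:\Omega\to\mathbb{R}$, where $\Omega=[q]^N$, the following holds. Let $X\in\Omega$ be distributed according to the Curie--Weiss--Potts model with inverse temperature $\beta$ on $N$ vertices, and let $Y\in\Omega$ be a random configuration where the colour of each vertex is sampled independently and uniformly at random from $[q]$. Then $$|\mathbb{E}h(X)-\mathbb{E}h(Y)|\le\|L(h)\|_\infty\,\theta^*\sqrt N .$$
   Context: $[q]=\{1,\dots,q\}$. The Curie--Weiss--Potts model on $N$ vertices with inverse temperature $\beta$ is the probability measure on $\Omega=[q]^N$ given by $\mu(\sigma)=e^{-\beta H(\sigma)}/Z(\beta)$, where $H(\sigma)=-\frac1N\sum_{u,v\in[N]}\mathbf 1_{\{\sigma(u)=\sigma(v)\}}$ (sum over all ordered pairs) and $Z(\beta)=\sum_{\sigma}e^{-\beta H(\sigma)}$. The spinodal inverse temperature is $$\beta_s(q)=\sup\Big\{\beta\ge0:\ \Big(1+(q-1)e^{2\beta\frac{1-qx}{q-1}}\Big)^{-1}-x\ne0\ \text{ for all }x\in(1/q,1)\Big\}.$$ For $h:\Omega\to\mathbb R$ and a vertex $v\in[N]$, $L_v(h)=\sup|h(\sigma)-h(\tau)|$ over all pairs $\sigma,\tau\in\Omega$ with $\sigma(u)=\tau(u)$ for all $u\ne v$, and $\|L(h)\|_\infty=\max_{v}L_v(h)$. *)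

(* Defs.v *)
From mathcomp Require Import all_boot all_order all_algebra.
From mathcomp Require Import all_classical all_reals all_analysis.

Set Implicit Arguments.
Unset Strict Implicit.
Unset Printing Implicit Defensive.

Import Order.TTheory GRing.Theory Num.Theory.

Local Open Scope classical_set_scope.
Local Open Scope ring_scope.

(* The colours 1, ..., q and the vertices 1, ..., N are indexed from 0. *)
Notation config N q := {ffun 'I_N -> 'I_q}.

Section CurieWeissPotts.
Context {R : realType}.

(* The sum ranges over all ordered pairs (u, v), diagonal included. *)
Definition cwp_hamiltonian (N q : nat) (s : config N q) : R :=
  - (N%:R^-1 * \sum_(u < N) \sum_(v < N) (s u == s v)%:R).

Definition cwp_partition (N q : nat) (beta : R) : R :=
  \sum_(s : config N q) expR (- beta * cwp_hamiltonian s).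

Definition cwp_mass (N q : nat) (beta : R) (s : config N q) : R :=
  expR (- beta * cwp_hamiltonian s) / cwp_partition N q beta.

(* For q >= 2 the set below contains 0 and is bounded above, so that this
   supremum is not the default value of [sup]. *)
Definition beta_s (q : nat) : R :=
  sup [set beta : R | 0 <= beta /\
    forall x : R, q%:R^-1 < x < 1 ->
      (1 + (q%:R - 1)
           * expR (2 * beta * ((1 - q%:R * x) / (q%:R - 1))))^-1 - x != 0].

Definition vertex_osc (N q : nat) (h : config N q -> R) (v : 'I_N) : R :=
  sup [set r : R | exists s t : config N q,
    (forall u, u != v -> s u = t u) /\ r = `|h s - h t|].

(* The oscillations being nonnegative, 0 is neutral for their maximum. *)
Definition lip_norm (N q : nat) (h : config N q -> R) : R :=
  \big[Num.max/0]_(v < N) vertex_osc h v.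

Definition finite_rv d (T : measurableType d) (F : finType) (X : T -> F) : Prop :=
  forall A : set F, measurable (X @^-1` A).

Definition distributed_cwp d (T : measurableType d) (P : probability T R)
    (N q : nat) (beta : R) (X : T -> config N q) : Prop :=
  finite_rv X /\
  forall s : config N q, P [set t | X t = s] = (cwp_mass beta s)%:E.

Definition mutually_independent d (T : measurableType d) (P : probability T R)
    (I F : finType) (Z : I -> T -> F) : Prop :=
  forall (J : {set I}) (A : I -> set F),
    P [set t | forall i, i \in J -> A i (Z i t)] =
    (\prod_(i in J) P (Z i @^-1` A i))%E.

Definition distributed_iid_uniform d (T : measurableType d)
    (P : probability T R) (N q : nat) (Y : T -> config N q) : Prop :=
  [/\ forall v : 'I_N, finite_rv (fun t => Y t v),
      forall (v : 'I_N) (c : 'I_q), P [set t | Y t v = c] = (q%:R^-1)%:E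
    & mutually_independent P (fun (v : 'I_N) t => Y t v)].

End CurieWeissPotts.

(* Main.v *)
(* The Gibbs weight of a configuration s is a function of D(s), the vector of
   colour counts minus N/q: the mass is proportional to exp(beta |D|^2 / N).

   Concentration.  Pick g > beta in the set defining beta_s.  The fixed-point
   condition says that the derivative of a one-variable function has constant
   sign, which yields sum_i exp(l_i) <= q exp(|l|^2 / (4 g)) for centred l: a
   quadratic majorant of exp, tangent at one point and secant at another, shows
   that the worst l has q - 1 equal entries.  Adding one uniform vertex then
   turns the weight exp(a |D|^2) into at most exp(a + (a + a^2 / g) |D|^2), and
   iterating N times gives E exp(g' |D|^2 / N) = O(1) under the uniform measure
   for each g' < g.  Hence E |D|^2 = O(N) under the Gibbs measure, and under the
   uniform measure, which is the case beta = 0.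

   Comparison.  Both laws are invariant under permutations of the vertices, so h
   may be averaged over them; it then depends on the colour counts only, and is
   Lipschitz in them since counts are matched by recolouring one vertex at a
   time.  Thus |E h(X) - E h(Y)| is at most |L(h)| (E|D(X)|_1 + E|D(Y)|_1). *)

Require Import Defs.
From mathcomp Require Import all_boot all_order all_algebra.
From mathcomp Require Import all_classical all_reals all_analysis.
From mathcomp Require Import fingroup perm ring lra.

Set Implicit Arguments.
Unset Strict Implicit.
Unset Printing Implicit Defensive.

Import Order.TTheory GRing.Theory Num.Theory.
Import numFieldNormedType.Exports.

Local Open Scope classical_set_scope.
Local Open Scope ring_scope.

(** * One-variable inequalities for the exponential *)

Lemma is_derive_le {R : realType} (f df : R -> R) (a b : R) :
  (forall x : R, is_derive x 1 f (df x)) -> a <= b ->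
  (forall x, a <= x <= b -> 0 <= df x) -> f a <= f b.
Proof.
move=> fdf ab df0.
have [|c + e] := @MVT_segment R f df a b ab (fun x _ => fdf x).
  by apply: derivable_within_continuous => x _; apply: ex_derive.
by rewrite in_itv/= => c_ab; rewrite -subr_ge0 e mulr_ge0 ?subr_ge0 ?df0.
Qed.

Lemma expR_ge_quadratic {R : realType} (x : R) :
  0 <= x -> 2 + 2 * x + x ^+ 2 <= 2 * expR x.
Proof.
move=> x0; rewrite -subr_ge0.
have <- : 2 * expR 0 - (2 + 2 * 0 + 0 ^+ 2) = 0 :> R by rewrite expR0; ring.
apply: (@is_derive_le R (fun y => 2 * expR y - (2 + 2 * y + y ^+ 2))
  (fun y => 2 * (expR y - (1 + y)))) => // y.
  by apply: is_derive_eq; rewrite /GRing.scale /=; ring.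
by rewrite mulr_ge0 ?subr_ge0 ?expR_ge1Dx.
Qed.

(** The quadratic tangent to [expR] at 0 and meeting it again at [T] stays above it up to [T]. Up to
    the factor [T ^+ 2], [f] is the quotient of the two; it decreases up to 0, then increases, then
    decreases again, and takes the value [T ^+ 2] at both 0 and [T]. *)
Lemma expR_taylor_ratio_le {R : realType} (z T : R) : 0 <= T -> z <= T ->
  T ^+ 2 * (expR z - 1 - z) <= z ^+ 2 * (expR T - 1 - T).
Proof.
move=> T0 zT; set K := expR T - 1 - T.
have K2 : T ^+ 2 <= 2 * K by have := expR_ge_quadratic T0; rewrite /K; lra.
have K0 : 0 <= K by have := sqr_ge0 T; lra.
pose f (y : R) := (T ^+ 2 + T ^+ 2 * y + K * y ^+ 2) * expR (- y).
pose df (y : R) := expR (- y) * (y * (2 * K - T ^+ 2 - K * y)).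
have fdf (y : R) : is_derive y 1 f (df y).
  rewrite /f; apply: is_derive_eq; rewrite /df /GRing.scale /=; ring.
have f0 : f 0 = T ^+ 2 by rewrite /f oppr0 expR0; ring.
have fT : f T = T ^+ 2.
  rewrite /f (_ : _ + _ = T ^+ 2 * expR T); last by rewrite /K; ring.
  by rewrite -mulrA -expRD subrr expR0 mulr1.
suff : T ^+ 2 <= f z.
  move=> /(ler_wpM2r (expR_ge0 z)).
  rewrite /f -[leRHS]mulrA -expRD addNr expR0 mulr1; lra.
have [z0|z0] := leP z 0.
  rewrite -f0 -lerN2.
  apply: (@is_derive_le R (fun y => - f y) (fun y => - df y)) => // y /andP[_ y0].
  rewrite /df -mulrN mulr_ge0 ?expR_ge0 // -mulNr mulr_ge0 ?oppr_ge0 //.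
  by rewrite subr_ge0 (le_trans (y := 0)) ?mulr_ge0_le0 // subr_ge0.
have [Kz|Kz] := leP (K * z) (2 * K - T ^+ 2).
  rewrite -f0; apply: (@is_derive_le R f df) => //; first exact: ltW.
  move=> y /andP[y0 yz]; rewrite /df !mulr_ge0 ?expR_ge0 //.
  by rewrite subr_ge0 (le_trans _ Kz) // ler_wpM2l.
rewrite -fT -lerN2.
apply: (@is_derive_le R (fun y => - f y) (fun y => - df y)) => // y /andP[zy _].
have y0 : 0 <= y := le_trans (ltW z0) zy.
rewrite /df -mulrN -[- (y * _)]mulrN !mulr_ge0 ?expR_ge0 //.
by rewrite oppr_ge0 subr_le0 (le_trans (ltW Kz)) // ler_wpM2l.
Qed.

(** * The fixed-point condition and the exponential sum of a centred vector *)

Definition no_fixpoint {R : realType} (q : nat) (g : R) :=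
  forall x : R, q%:R^-1 < x < 1 ->
      (1 + (q%:R - 1)
           * expR (2 * g * ((1 - q%:R * x) / (q%:R - 1))))^-1 - x != 0.

(** The map takes values below 1, so a point with value at least [x] would force, by the
    intermediate value theorem on [[x, 1]], a forbidden fixed point. Points [x >= 1] are included
    because the substitution in [mgf_extremal] is unbounded. *)
Lemma no_fixpoint_lt {R : realType} (q : nat) (g x : R) :
  (2 <= q)%N -> no_fixpoint q g -> q%:R^-1 < x ->
  (1 + (q%:R - 1) * expR (2 * g * ((1 - q%:R * x) / (q%:R - 1))))^-1 < x.
Proof.
move=> q2 nf qx.
have q1 : 0 < q%:R - 1 :> R by rewrite subr_gt0 ltr1n.
pose s (y : R) :=
  (1 + (q%:R - 1) * expR (2 * g * ((1 - q%:R * y) / (q%:R - 1))))^-1.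
have s1 y : s y < 1.
  by rewrite invf_lt1 ?addr_gt0 ?mulr_gt0 ?expR_gt0// ltrDl mulr_gt0 ?expR_gt0.
have [x1|x1] := leP 1 x; first exact: lt_le_trans (s1 x) x1.
rewrite -/(s x) ltNge; apply/negP => xs.
have [||c + sc] := @IVT R (fun y => s y - y) x 1 0 (ltW x1).
- apply: continuous_subspaceT => y.
  apply: cvgB; last exact: cvg_id.
  apply: cvgV; first by rewrite gt_eqF // addr_gt0 ?mulr_gt0 ?expR_gt0.
  apply: cvgD; first exact: cvg_cst.
  apply: cvgM; first exact: cvg_cst.
  apply: continuous_cvg; first exact: continuous_expR.
  apply: cvgM; first exact: cvg_cst.
  apply: cvgM; last exact: cvg_cst.
  apply: cvgB; first exact: cvg_cst.
  apply: cvgM; first exact: cvg_cst.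
  exact: cvg_id.
- rewrite ge_min le_max subr_ge0 xs orTb andbT; apply/orP; right.
  by rewrite subr_le0 ltW.
rewrite in_itv /= => /andP[xc]; rewrite le_eqVlt => /predU1P[c1|c1].
  by have := s1 c; rewrite -subr_lt0 -[X in _ - X]c1 sc ltxx.
by have := nf c; rewrite (lt_le_trans qx xc) c1 => /(_ isT) /eqP; apply.
Qed.

(** After division by [expR r], this is the bound for the centred vector with one entry [(q - 1) r]
    and all others [- r], whose squared norm is [q (q - 1) r ^+ 2]. The quotient of the two sides
    decreases in [r]. *)
Lemma mgf_extremal {R : realType} (q : nat) (g r : R) :
  (2 <= q)%N -> 0 < g -> no_fixpoint q g -> 0 <= r ->
  expR (q%:R * r) + (q%:R - 1) <=
  q%:R * expR (r + q%:R * (q%:R - 1) * r ^+ 2 / (4 * g)).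
Proof.
move=> q2 g0 nf r0.
have q1 : 0 < q%:R - 1 :> R by rewrite subr_gt0 ltr1n.
have q0 : 0 < q%:R :> R by rewrite ltr0n (leq_trans _ q2).
pose k : R := q%:R * (q%:R - 1) / (4 * g).
pose f (y : R) := (expR (q%:R * y) + (q%:R - 1)) * expR (- y - k * y ^+ 2).
pose df (y : R) := expR (- y - k * y ^+ 2) *
  ((q%:R - 1) * (expR (q%:R * y) - 1)
    - 2 * k * y * (expR (q%:R * y) + (q%:R - 1))).
have fdf (y : R) : is_derive y 1 f (df y).
  rewrite /f; apply: is_derive_eq; rewrite /df /GRing.scale /=; ring.
suff : f r <= f 0.
  rewrite /f !mulr0 expr0n /= mulr0 oppr0 addr0 expR0 mulr1 (addrC 1) subrK.
  move=> /(ler_wpM2r (expR_ge0 (r + k * r ^+ 2))); rewrite -[leLHS]mulrA -expRD.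
  rewrite -opprD addNr expR0 mulr1 => /le_trans; apply.
  by rewrite /k mulrAC.
rewrite -lerN2; apply: (@is_derive_le R (fun y => - f y) (fun y => - df y)) => //.
move=> y /andP[y0 _]; rewrite /df -mulrN mulr_ge0 ?expR_ge0 // opprB subr_ge0.
move: y0; rewrite le_eqVlt => /predU1P[<-|y0].
  by rewrite !mulr0 expR0 subrr mulr0 mul0r.
set S := expR (q%:R * y) + (q%:R - 1).
have S0 : 0 < S by rewrite addr_gt0 ?expR_gt0.
(* This [x] turns the exponent of the fixed-point map into [- (q * y)]; the strict inequality at [x]
   is then the sign of [df y]. *)
pose x : R := q%:R^-1 + (q%:R - 1) * y / (2 * g).
have qx : q%:R^-1 < x by rewrite ltrDl divr_gt0 ?mulr_gt0.
have := no_fixpoint_lt q2 nf qx.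
rewrite (_ : 2 * g * _ = - (q%:R * y)); last first.
  by rewrite /x; field; rewrite !gt_eqF.
rewrite (_ : _^-1 = expR (q%:R * y) / S); last first.
  rewrite expRN /S; field.
  by rewrite -/S !gt_eqF // expR_gt0.
rewrite ltr_pdivrMr // => /ltW h.
have -> : 2 * k * y * S = q%:R * (x * S) - S.
  by rewrite /k /x; field; rewrite !gt_eqF.
rewrite lerBrDr (le_trans _ (ler_wpM2l (ltW q0) h)) // /S; lra.
Qed.

(** The squares summed in the proof vanish for [j != i] exactly when all other entries are equal, so
    keeping only the term [j = i] gives the sharp constant. *)
Lemma sqr_centered_le {R : realType} (q : nat) (lam : 'I_q -> R) (i : 'I_q) :
  (2 <= q)%N -> \sum_j lam j = 0 ->
  q%:R * lam i ^+ 2 <= (q%:R - 1) * \sum_j lam j ^+ 2.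
Proof.
move=> q2 lam0.
have q1 : 0 < q%:R - 1 :> R by rewrite subr_gt0 ltr1n.
have e : \sum_j ((q%:R - 1) * lam j + lam i) ^+ 2 =
    (q%:R - 1) ^+ 2 * \sum_j lam j ^+ 2 + q%:R * lam i ^+ 2.
  transitivity (\sum_j ((q%:R - 1) ^+ 2 * lam j ^+ 2 +
      2 * (q%:R - 1) * lam i * lam j + lam i ^+ 2)).
    by apply: eq_bigr => j _; ring.
  rewrite !big_split /= -!mulr_sumr sumr_const card_ord lam0 -mulr_natl; ring.
have : ((q%:R - 1) * lam i + lam i) ^+ 2 <=
    \sum_j ((q%:R - 1) * lam j + lam i) ^+ 2.
  by rewrite (bigD1 i) //= lerDl sumr_ge0 // => j _; rewrite sqr_ge0.
by rewrite e => h; rewrite -(ler_pM2l q1); lra.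
Qed.

(** Shifted by [r], the extremal vector has entries [q r] and 0, the points where the quadratic
    majorant agrees with [expR]. The sum of the majorant sees only the sum and the sum of squares of
    the entries, which [lam] shares with the extremal vector. *)
Lemma sum_expR_centered_le {R : realType} (q : nat) (g : R) (lam : 'I_q -> R) :
  (2 <= q)%N -> 0 < g -> no_fixpoint q g -> \sum_i lam i = 0 ->
  \sum_i expR (lam i) <= q%:R * expR ((\sum_i lam i ^+ 2) / (4 * g)).
Proof.
move=> q2 g0 nf lam0; set s := \sum_i lam i ^+ 2.
have q1 : 0 < q%:R - 1 :> R by rewrite subr_gt0 ltr1n.
have q0 : 0 < q%:R :> R by rewrite ltr0n (leq_trans _ q2).
have s0 : 0 <= s by apply: sumr_ge0 => i _; rewrite sqr_ge0.
(* Chosen so that the vector of [mgf_extremal] has squared norm [s]. *)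
pose r := Num.sqrt (s / (q%:R * (q%:R - 1))).
have r0 : 0 <= r by rewrite sqrtr_ge0.
have rs : s = q%:R * (q%:R - 1) * r ^+ 2.
  rewrite sqr_sqrtr; first by rewrite mulrC divfK // gt_eqF ?mulr_gt0.
  by rewrite divr_ge0 // ltW ?mulr_gt0.
have lamr i : lam i + r <= q%:R * r.
  rewrite -lerBrDr (_ : _ - r = (q%:R - 1) * r); last by ring.
  apply: (le_trans (ler_norm _)).
  rewrite -(ler_pXn2r (n := 2)) ?nnegrE ?normr_ge0 ?mulr_ge0 ?(ltW q1) //.
  rewrite real_normK ?num_real // -(ler_pM2l q0).
  have := sqr_centered_le i q2 lam0; rewrite -/s rs; lra.
suff : \sum_i expR (lam i + r) <= expR (q%:R * r) + (q%:R - 1).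
  move=> /le_trans /(_ (mgf_extremal q2 g0 nf r0)).
  rewrite rs expRD; under eq_bigr => i _ do rewrite expRD mulrC.
  by rewrite -mulr_sumr mulrCA ler_pM2l ?expR_gt0.
have [r00|r_gt0] : r = 0 \/ 0 < r.
  by move: r0; rewrite le_eqVlt => /predU1P[|]; auto.
  have l0 i : lam i = 0.
    apply/eqP; rewrite -(sqrf_eq0 (lam i)); apply/eqP.
    move/eqP: rs; rewrite r00 expr0n /= mulr0 psumr_eq0 => [/allP/(_ i)|j _].
      by rewrite mem_index_enum => /(_ isT)/eqP.
    by rewrite sqr_ge0.
  under eq_bigr => i _ do rewrite l0 r00 addr0 expR0.
  by rewrite sumr_const card_ord r00 mulr0 expR0 addrC subrK.
have qr0 : 0 < (q%:R * r) ^+ 2 by rewrite exprn_gt0 ?mulr_gt0.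
rewrite -(ler_pM2l qr0) mulr_sumr.
have h i := expR_taylor_ratio_le (mulr_ge0 (ltW q0) r0) (lamr i).
apply: (@le_trans _ _ (\sum_i
    ((lam i + r) ^+ 2 * (expR (q%:R * r) - 1 - q%:R * r)
    + (q%:R * r) ^+ 2 * (1 + (lam i + r))))).
  by apply: ler_sum => i _; have := h i; lra.
rewrite big_split /= -mulr_suml -mulr_sumr.
have -> : \sum_i (lam i + r) ^+ 2 = (q%:R * r) ^+ 2.
  transitivity (\sum_i (lam i ^+ 2 + 2 * r * lam i + r ^+ 2)).
    by apply: eq_bigr => i _; ring.
  rewrite !big_split /= -!mulr_sumr sumr_const card_ord -/s lam0 rs -mulr_natl.
  ring.
rewrite !big_split /= lam0 !sumr_const card_ord -[r *+ q]mulr_natl.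
lra.
Qed.

Lemma sum_sqr_add_centered_delta {R : realType} (q : nat) (w : 'I_q -> R)
    (i : 'I_q) :
  (0 < q)%N -> \sum_j w j = 0 ->
  \sum_j (w j + ((i == j)%:R - q%:R^-1)) ^+ 2 =
  \sum_j w j ^+ 2 + 2 * w i + (1 - q%:R^-1).
Proof.
move=> q0 w0; have qn0 : q%:R != 0 :> R by rewrite pnatr_eq0 -lt0n.
transitivity (\sum_j (w j ^+ 2 - 2 * q%:R^-1 * w j + q%:R^-1 ^+ 2 +
    (if i == j then 2 * w j + 1 - 2 * q%:R^-1 else 0))).
  by apply: eq_bigr => j _; case: (i == j) => /=; ring.
have e : \sum_(j < q) (if i == j then 2 * w j + 1 - 2 * q%:R^-1 else 0) =
    2 * w i + 1 - 2 * q%:R^-1.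
  by rewrite (bigD1 i) //= eqxx big1 ?addr0 // => j; rewrite eq_sym => /negPf ->.
rewrite !big_split /= e sumrN -mulr_sumr w0 sumr_const card_ord -mulr_natl.
by field.
Qed.

(** Expanding the square leaves the exponential sum of the centred vector [2 a w], for which the
    previous bound contributes [a ^+ 2 / g] times the squared norm of [w]. *)
Lemma sum_expR_step_le {R : realType} (q : nat) (g a : R) (w : 'I_q -> R) :
  (2 <= q)%N -> 0 < g -> no_fixpoint q g -> 0 <= a -> \sum_j w j = 0 ->
  \sum_i expR (a * \sum_j (w j + ((i == j)%:R - q%:R^-1)) ^+ 2) <=
  q%:R * expR (a + (a + a ^+ 2 / g) * \sum_j w j ^+ 2).
Proof.
move=> q2 g0 nf a0 w0; have q0 : (0 < q)%N by rewrite (leq_trans _ q2).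
set W := \sum_j w j ^+ 2.
under eq_bigr => i _ do
  rewrite sum_sqr_add_centered_delta // -/W -addrA addrCA mulrDr expRD mulrA.
have lam0 : \sum_i a * 2 * w i = 0 by rewrite -mulr_sumr w0 mulr0.
rewrite -mulr_suml.
apply: (le_trans (ler_wpM2r (expR_ge0 _) (sum_expR_centered_le q2 g0 nf lam0))).
rewrite -mulrA -expRD ler_pM2l ?ltr0n // ler_expR.
under eq_bigr => i _ do rewrite exprMn.
rewrite -mulr_sumr -/W.
rewrite (_ : _ / _ = a ^+ 2 / g * W); last by field; rewrite gt_eqF.
rewrite mulrDr [leRHS]addrC mulrDl addrA.
rewrite [leLHS](_ : _ = a * W + a ^+ 2 / g * W + a * (1 - q%:R^-1)); last first.
  by ring.
by rewrite lerD2l ler_piMr // lerBlDr lerDl invr_ge0.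
Qed.

(** * Exponential moment of the colour deviations under the uniform measure *)

Definition recolour (N q : nat) (s : config N q) (v : 'I_N) (i : 'I_q) :
    config N q :=
  [ffun u => if u == v then i else s u].

(** Exchanging the new colour with the old one at [v] is an involution on pairs of a configuration
    and a colour. *)
Lemma sum_recolour {R : realType} (N q : nat) (v : 'I_N) (F : config N q -> R) :
  \sum_s \sum_i F (recolour s v i) = q%:R * \sum_s F s.
Proof.
pose swap (p : config N q * 'I_q) := (recolour p.1 v p.2, p.1 v).
have swapK : involutive swap.
  case=> s i; congr pair => /=; last by rewrite ffunE eqxx.
  by apply/ffunP => u; rewrite !ffunE; case: eqVneq => [->|].
rewrite pair_big /= (reindex_inj (inv_inj swapK)) /=.
transitivity (\sum_(p : config N q * 'I_q) F p.1).
  by apply: eq_bigr => p _; rewrite -[in RHS](swapK p).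
rewrite -(pair_big xpredT xpredT (fun s (_ : 'I_q) => F s)) /= mulr_sumr.
by apply: eq_bigr => s _; rewrite sumr_const card_ord mulr_natl.
Qed.

Section Deviation.
Context {R : realType} (N q : nat).
Implicit Types s : config N q.

(** Truncating at [k] while keeping whole configurations lets the induction on [k] run over one
    fixed sample space; [k = N] gives the vector D(s). *)
Definition partial_dev (k : nat) s (j : 'I_q) : R :=
  \sum_(v < N | (v < k)%N) ((s v == j)%:R - q%:R^-1).

Definition sqdev s : R := \sum_j partial_dev N s j ^+ 2.

Lemma sum_partial_dev (k : nat) s : (0 < q)%N -> \sum_j partial_dev k s j = 0.
Proof.
move=> q0; rewrite exchange_big /= big1 // => v _.
rewrite big_split /= sumrN sumr_const card_ord -[_^-1 *+ q]mulr_natl divff;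
  last by rewrite pnatr_eq0 -lt0n.
rewrite (bigD1 (s v)) //= eqxx big1 ?addr0 ?subrr // => j.
by rewrite eq_sym => /negPf ->.
Qed.

Lemma partial_dev_recolour (k : nat) s (kN : (k < N)%N) (i j : 'I_q) :
  partial_dev k.+1 (recolour s (Ordinal kN) i) j =
  partial_dev k s j + ((i == j)%:R - q%:R^-1).
Proof.
rewrite /partial_dev (bigD1 (Ordinal kN)) //= ffunE eqxx addrC; congr (_ + _).
apply: eq_big => [v|v /andP[_ /negPf vk]]; last by rewrite ffunE vk.
by rewrite ltnS -val_eqE /= [RHS]ltn_neqAle andbC.
Qed.

Lemma sum_expR_partial_dev_le (g g' : R) (k : nat) : (2 <= q)%N -> (0 < N)%N ->
  no_fixpoint q g -> 0 < g' < g -> (k <= N)%N ->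
  \sum_s expR (g * g' / (N%:R * (g - g') + k%:R * g') *
    \sum_j partial_dev k s j ^+ 2) <=
  #|{: config N q}|%:R * expR (k%:R * (g * g' / (g - g') / N%:R)).
Proof.
move=> q2 N0 nf /andP[g'0 g'g]; set A := g * g' / (g - g').
have q0 : (0 < q)%N by rewrite (leq_trans _ q2).
have g0 : 0 < g := lt_trans g'0 g'g.
have gg : 0 < g - g' by rewrite subr_gt0.
have N0' : 0 < N%:R :> R by rewrite ltr0n.
elim: k => [_|k IH kN].
  have e s : \sum_j partial_dev 0 s j ^+ 2 = 0.
    by apply: big1 => j _; rewrite /partial_dev big1 ?expr0n.
  under eq_bigr => s _ do rewrite e mulr0 expR0.
  by rewrite sumr_const mul0r expR0 mulr1.
(* Averaging over the colour of one vertex turns the weight with coefficient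
   [c k.+1] into at most [exp (c k.+1)] times the weight with
   [c k.+1 + c k.+1 ^+ 2 / g <= c k]; the last coefficient is [c N = g' / N]. *)
set c := fun k : nat => g * g' / (N%:R * (g - g') + k%:R * g').
have den l : 0 < N%:R * (g - g') + l%:R * g'.
  by rewrite ltr_pwDl ?mulr_gt0 // mulr_ge0 ?ler0n // ltW.
have c_ge0 l : 0 <= c l by rewrite /c divr_ge0 ?mulr_ge0 // ltW.
(* [A / N] is the value [c 0]; this bound, uniform in [k], makes all [N] steps cost at most
   [expR A]. *)
have cA : c k.+1 <= A / N%:R.
  rewrite /c /A -[leRHS]mulrA -invfM ler_pM2l ?mulr_gt0 //.
  rewrite lef_pV2 ?posrE ?mulr_gt0 //.
  by rewrite [leLHS]mulrC lerDl mulr_ge0 // ltW.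
(* The reciprocal of [c] grows by [1 / g] at each step, so [c k = c k.+1 / (1 - c k.+1 / g)], and
   the left-hand side is the start of its geometric series. *)
have cS : c k.+1 + c k.+1 ^+ 2 / g <= c k.
  set B := N%:R * (g - g') + k.+1%:R * g'.
  have B0 : 0 < B by exact: den.
  have Bg : 0 < B - g' by rewrite /B -natr1; have := den k; lra.
  have -> : c k = g * g' / (B - g').
    by rewrite /c /B -natr1; congr (_ / _); ring.
  have -> : c k.+1 + c k.+1 ^+ 2 / g = g * g' * (B + g') / B ^+ 2.
    by rewrite /c -/B; field; rewrite !gt_eqF.
  rewrite -[leLHS]mulrA ler_pM2l ?mulr_gt0 // ler_pdivrMr ?exprn_gt0 //.
  rewrite mulrC ler_pdivlMr //; have := sqr_ge0 g'; lra.
rewrite -(@ler_pM2l _ q%:R) ?ltr0n // -(sum_recolour (Ordinal kN)).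
apply: (@le_trans _ _ (\sum_s q%:R * (expR (A / N%:R) *
    expR (c k * \sum_j partial_dev k s j ^+ 2)))).
  apply: ler_sum => s _.
  under eq_bigr => i _ do under eq_bigr => j _ do rewrite partial_dev_recolour.
  apply: (le_trans (sum_expR_step_le q2 g0 nf (c_ge0 _) (sum_partial_dev _ s q0))).
  rewrite ler_pM2l ?ltr0n // -expRD ler_expR lerD //.
  by rewrite ler_wpM2r // sumr_ge0 // => j _; rewrite sqr_ge0.
rewrite -!mulr_sumr ler_pM2l ?ltr0n //.
apply: (le_trans (ler_wpM2l (expR_ge0 _) (IH (ltnW kN)))).
rewrite mulrCA -expRD -natr1 mulrDl mul1r addrC.
exact: lexx.
Qed.

Lemma sum_expR_sqdev_le (g g' : R) : (2 <= q)%N -> (0 < N)%N ->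
  no_fixpoint q g -> 0 < g' < g ->
  \sum_s expR (g' / N%:R * sqdev s) <=
  #|{: config N q}|%:R * expR (g * g' / (g - g')).
Proof.
move=> q2 N0 nf gg; have := sum_expR_partial_dev_le q2 N0 nf gg (leqnn N) => /=.
have /andP[g'0 g'g] := gg.
have N0' : N%:R != 0 :> R by rewrite pnatr_eq0 -lt0n.
have g0 : g != 0 by rewrite gt_eqF // (lt_trans g'0).
rewrite (mulrC N%:R (_ / _)) divfK //.
rewrite -mulrDr subrK (_ : g * g' / _ = g' / N%:R) //; field.
by rewrite N0' g0.
Qed.

(** * Colour counts and the Hamiltonian *)

Definition card_colour s (j : 'I_q) : nat := #|[pred v | s v == j]|.

Lemma sumn_card_colour s : (\sum_j card_colour s j = N)%N.
Proof.
rewrite -[RHS]card_ord -sum1_card (partition_big s xpredT) //=.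
by apply: eq_bigr => j _; rewrite sum1_card.
Qed.

Lemma partial_dev_full s j :
  partial_dev N s j = ((card_colour s j)%:R - N%:R / q%:R).
Proof.
rewrite /partial_dev (eq_bigl xpredT) => [|v]; last by rewrite ltn_ord.
rewrite big_split /= sumrN sumr_const card_ord -[_ *+ N]mulr_natl; congr (_ - _).
rewrite /card_colour -sum1_card natr_sum [RHS]big_mkcond /=.
by apply: eq_bigr => v _; rewrite inE; case: (s v == j).
Qed.

Lemma sum_card_colour s : \sum_j (card_colour s j)%:R = N%:R :> R.
Proof. by rewrite -natr_sum sumn_card_colour.
Qed.

(** Grouping equal pairs by colour gives the squared counts. The Hamiltonian thus depends on [sqdev]
    alone, up to a constant that cancels in the Gibbs mass. *)
Lemma sum_same_colour s : (0 < q)%N ->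
  \sum_(u < N) \sum_(v < N) (s u == s v)%:R =
  sqdev s + N%:R ^+ 2 / q%:R :> R.
Proof.
move=> q0; have qn0 : q%:R != 0 :> R by rewrite pnatr_eq0 -lt0n.
have -> : sqdev s = \sum_j ((card_colour s j)%:R) ^+ 2 - N%:R ^+ 2 / q%:R.
  transitivity (\sum_j ((card_colour s j)%:R ^+ 2 -
      2 * (N%:R / q%:R) * (card_colour s j)%:R + (N%:R / q%:R) ^+ 2) : R).
    by apply: eq_bigr => j _; rewrite partial_dev_full; ring.
  rewrite !big_split /= sumrN -mulr_sumr sum_card_colour sumr_const card_ord.
  by rewrite -[_ *+ q]mulr_natl; field.
rewrite subrK (partition_big s xpredT) //=; apply: eq_bigr => j _.
transitivity (\sum_(u < N | s u == j) (card_colour s j)%:R : R).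
  apply: eq_bigr => u /eqP ->; rewrite /card_colour -sum1_card natr_sum.
  by rewrite [RHS]big_mkcond /=; apply: eq_bigr => v _; rewrite inE eq_sym; case: (s v == j).
by rewrite sumr_const -[_ *+ _]mulr_natl expr2.
Qed.

End Deviation.

(** * Symmetrisation over vertices and Lipschitz dependence on the counts *)

Section Lipschitz.
Context {R : realType} (N q : nat).
Implicit Types (s t : config N q) (h : config N q -> R).

Lemma lip_norm_ge0 h : 0 <= lip_norm h.
Proof. exact: bigmax_ge_id. Qed.

Lemma lip_norm_le h s t (v : 'I_N) : (forall u, u != v -> s u = t u) ->
  `|h s - h t| <= lip_norm h.
Proof.
move=> st; apply: (le_trans _ (le_bigmax _ _ v)); apply: ub_le_sup.
  (* A crude upper bound, needed for [sup] to dominate the elements of its set. *)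
  exists (\sum_s0 \sum_t0 `|h s0 - h t0|) => _ [s0 [t0 [_ ->]]].
  rewrite (bigD1 s0) //= (bigD1 t0) //= -addrA lerDl addr_ge0 ?sumr_ge0 // => i _.
  by rewrite sumr_ge0.
by exists s, t.
Qed.

Definition permute s (p : 'S_N) : config N q := [ffun v => s (p v)].

Lemma permuteM s (p r : 'S_N) : permute (permute s p) r = permute s (r * p)%g.
Proof. by apply/ffunP => v; rewrite !ffunE permM. Qed.

Lemma permute_inj (p : 'S_N) : injective (permute^~ p).
Proof.
by apply: (can_inj (g := permute^~ (p^-1)%g)) => s; rewrite permuteM mulVg;
  apply/ffunP => v; rewrite ffunE perm1.
Qed.

Lemma cwp_mass_permute (b : R) s (p : 'S_N) :
  cwp_mass b (permute s p) = cwp_mass b s.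
Proof.
congr (expR (_ * - (_ * _)) / _).
rewrite [RHS](reindex_inj (@perm_inj _ p)); apply: eq_bigr => u _ /=.
rewrite [RHS](reindex_inj (@perm_inj _ p)); apply: eq_bigr => v _ /=.
by rewrite !ffunE.
Qed.

Definition symmetrise h s : R :=
  #|{: 'S_N}|%:R^-1 * \sum_(p : 'S_N) h (permute s p).

Let perm_card_neq0 : #|{: 'S_N}|%:R != 0 :> R.
Proof. by rewrite pnatr_eq0 -lt0n; apply/card_gt0P; exists 1%g. Qed.

Lemma symmetrise_permute h s (p : 'S_N) :
  symmetrise h (permute s p) = symmetrise h s.
Proof.
congr (_ * _); rewrite [RHS](reindex_inj (mulIg p)).
by apply: eq_bigr => r _; rewrite permuteM.
Qed.

(** The mass is invariant under vertex permutations, so each permuted copy of [h] has the same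
    mean. *)
Lemma sum_cwp_mass_symmetrise (b : R) h :
  \sum_s cwp_mass b s * symmetrise h s = \sum_s cwp_mass b s * h s.
Proof.
under eq_bigr => s _ do rewrite mulrCA mulr_sumr.
rewrite -mulr_sumr exchange_big /= (eq_bigr (fun=> \sum_s cwp_mass b s * h s)).
  by rewrite sumr_const -[_ *+ #|_|]mulr_natl mulKf.
move=> p _; rewrite [RHS](reindex_inj (@permute_inj p)).
by apply: eq_bigr => s _; rewrite cwp_mass_permute.
Qed.

Lemma symmetrise_lip h s t (v : 'I_N) : (forall u, u != v -> s u = t u) ->
  `|symmetrise h s - symmetrise h t| <= lip_norm h.
Proof.
move=> st; rewrite -mulrBr -sumrB normrM ger0_norm ?invr_ge0 //.
rewrite ler_pdivrMl; last by rewrite lt0r perm_card_neq0 ler0n.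
apply: (le_trans (ler_norm_sum _ _ _)).
rewrite mulr_natl -sumr_const; apply: ler_sum => p _.
(* The permuted configurations can differ only at the preimage of [v]. *)
apply: (@lip_norm_le _ _ _ ((p^-1)%g v)) => u uv.
by rewrite !ffunE; apply: st; apply: contraNneq uv => <-; rewrite permK.
Qed.

Lemma card_colour_recolour s v i j :
  (card_colour (recolour s v i) j + (s v == j) = card_colour s j + (i == j))%N.
Proof.
rewrite /card_colour (cardD1 v) [in RHS](cardD1 v) !inE ffunE eqxx.
rewrite addnAC [RHS]addnAC [X in (X + _)%N]addnC; congr (_ + _)%N.
apply: eq_card => u.
by rewrite !inE ffunE; case: eqVneq.
Qed.

(** Both families of counts add up to [N], which leaves no room for a strict inequality. *)
Lemma leq_card_colour s t : (forall j, (card_colour s j <= card_colour t j)%N) ->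
  forall j, card_colour s j = card_colour t j.
Proof.
move=> le j.
have := leqif_sum (fun i (_ : true) => leqif_eq (le i)).
by move=> [_]; rewrite !sumn_card_colour eqxx => /esym/forall_inP/(_ j isT)/eqP.
Qed.

Lemma eq_card_colour_permute s t : (forall j, card_colour s j = card_colour t j) ->
  exists p : 'S_N, s = permute t p.
Proof.
move=> st; have : perm_eq [tuple s v | v < N] [tuple t v | v < N].
  apply/allP => j _ /=; rewrite !count_map; apply/eqP.
  have := st j; rewrite /card_colour !cardE /enum_mem !size_filter.
  by rewrite -!enumT => e; etransitivity; first exact: e.
move=> /tuple_permP[p e]; exists p; apply/ffunP => v; rewrite ffunE.
have := congr1 (fun x => tnth x v) (val_inj e :
  [tuple s v | v < N] = [tuple tnth [tuple t v | v < N] (p i) | i < N]).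
by rewrite !tnth_mktuple.
Qed.

(** Induction on the total excess, where natural subtraction truncates at 0. A vertex of a colour in
    excess is recoloured with a colour in deficit, which lowers the excess by one; without excess
    the configurations are permutations of each other. *)
Lemma symmetrise_card_colour_lip h s t :
  `|symmetrise h s - symmetrise h t| <=
  lip_norm h * (\sum_j (card_colour s j - card_colour t j))%:R.
Proof.
have [d] := ubnP (\sum_j (card_colour s j - card_colour t j)).
elim: d s => // d IH s; rewrite ltnS => sd.
have [le_st|] := pselect (forall j, (card_colour s j <= card_colour t j)%N).
  have [p ->] := eq_card_colour_permute (leq_card_colour le_st).
  by rewrite symmetrise_permute subrr normr0 mulr_ge0 ?lip_norm_ge0.
move=> /existsNP[i /negP]; rewrite -ltnNge => ti_si.
have [le_ts|] := pselect (forall j, (card_colour t j <= card_colour s j)%N).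
  by rewrite (leq_card_colour le_ts) ltnn in ti_si.
move=> /existsNP[j /negP]; rewrite -ltnNge => sj_tj.
have /card_gt0P[v] : (0 < card_colour s i)%N by apply: leq_ltn_trans ti_si.
rewrite inE => /eqP svi.
have ij : i != j by apply: contraTneq sj_tj => <-; rewrite -leqNgt ltnW.
pose s' := recolour s v j.
have e : (\sum_k (card_colour s k - card_colour t k) =
    (\sum_k (card_colour s' k - card_colour t k)).+1)%N.
  rewrite (bigD1 i) //= [in RHS](bigD1 i) //= -addSn; congr (_ + _)%N.
    have := card_colour_recolour s v j i; rewrite svi eqxx eq_sym (negPf ij) -/s'.
    rewrite addn0 addn1 => e; have := ti_si; rewrite -e ltnS => le.
    by rewrite subSn.
  apply: eq_bigr => k ki; have := card_colour_recolour s v j k.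
  rewrite svi eq_sym (negPf ki) addn0 -/s' => ->.
  case: eqVneq => [<-|_]; last by rewrite addn0.
  (* Colour [j] was in strict deficit, so one more vertex leaves its truncated difference at 0. *)
  by apply/eqP; rewrite addn1 (eqP (sj_tj : (_ - _ == 0)%N)) subn_eq0 ltnW.
rewrite e -natr1 mulrDr mulr1 -(subrK (symmetrise h s') (symmetrise h s)).
rewrite -addrA addrC.
apply: (le_trans (ler_normD _ _)); apply: lerD.
  by apply: IH; rewrite -e.
by apply: (@symmetrise_lip _ _ _ v) => u uv; rewrite ffunE (negPf uv).
Qed.

Definition dev1 s : R := \sum_j `|partial_dev N s j|.

(** Both counts are compared with the balanced value [N / q]. *)
Lemma symmetrise_dev1_lip h s t :
  `|symmetrise h s - symmetrise h t| <= lip_norm h * (dev1 s + dev1 t).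
Proof.
apply: (le_trans (symmetrise_card_colour_lip _ _ _)).
rewrite ler_wpM2l ?lip_norm_ge0 // natr_sum -big_split; apply: ler_sum => j _ /=.
rewrite !partial_dev_full.
set x := _%:R / _; have [le|/ltnW le] := leqP (card_colour s j) (card_colour t j).
  by rewrite (eqP (le : (_ - _ == 0)%N)) addr_ge0.
rewrite natrB // (le_trans _ (ler_normB _ _)) // opprB addrA subrK.
exact: ler_norm.
Qed.

End Lipschitz.

(** * Moments under the Gibbs measure and comparison of means *)

Section Moments.
Context {R : realType} (N q : nat).
Hypotheses (q2 : (2 <= q)%N) (N0 : (0 < N)%N).
Implicit Types (b : R) (s : config N q).

Let q0 : (0 < q)%N. Proof. exact: leq_trans q2. Qed.

Let NR0 : 0 < N%:R :> R. Proof. by rewrite ltr0n. Qed.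

Lemma card_config_gt0 : (0 < #|{: config N q}|)%N.
Proof. by apply/card_gt0P; exists [ffun=> Ordinal q0]. Qed.

Lemma cwp_partition_gt0 b : 0 < cwp_partition N q b.
Proof.
have /card_gt0P[s _] := card_config_gt0.
rewrite /cwp_partition (bigD1 s) //= ltr_pwDl ?expR_gt0 // sumr_ge0 // => t _.
Qed.

Lemma cwp_mass_ge0 b s : 0 <= cwp_mass b s.
Proof. by rewrite divr_ge0 ?expR_ge0 // ltW ?cwp_partition_gt0. Qed.

Lemma sum_cwp_mass b : \sum_(s : config N q) cwp_mass b s = 1.
Proof. by rewrite -mulr_suml divff // gt_eqF // cwp_partition_gt0. Qed.

Lemma cwp_massE b s : cwp_mass b s =
  expR (b / N%:R * sqdev s) / \sum_(t : config N q) expR (b / N%:R * sqdev t).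
Proof.
have e (t : config N q) : expR (- b * cwp_hamiltonian t) =
    expR (b / N%:R * sqdev t) * expR (b / N%:R * (N%:R ^+ 2 / q%:R)).
  rewrite -expRD -mulrDr -sum_same_colour // /cwp_hamiltonian; congr expR.
  by rewrite mulrNN mulrA.
rewrite /cwp_mass /cwp_partition (eq_bigr _ (fun t _ => e t)) e -mulr_suml.
by rewrite invfM mulrACA divff ?mulr1 // gt_eqF // expR_gt0.
Qed.

Lemma cwp_mass0 s : cwp_mass 0 s = (#|{: config N q}|%:R)^-1 :> R.
Proof.
rewrite /cwp_mass /cwp_partition oppr0; under eq_bigr => t _ do rewrite mul0r expR0.
by rewrite mul0r expR0 sumr_const div1r.
Qed.

Lemma sqdev_ge0 s : 0 <= sqdev s :> R.
Proof. by apply: sumr_ge0 => j _; rewrite sqr_ge0. Qed.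

(** The gap [g' - b] pays for the factor [sqdev s], through [y <= expR y] at
    [y = (g' - b) / N * sqdev s]. As [b >= 0], the normalising sum is at least the number of
    configurations, so the uniform exponential moment suffices. *)
Lemma sum_cwp_mass_sqdev_le b (g g' : R) : 0 <= b < g' -> g' < g ->
  no_fixpoint q g ->
  \sum_(s : config N q) cwp_mass b s * sqdev s <=
  N%:R * (expR (g * g' / (g - g')) / (g' - b)).
Proof.
move=> /andP[b0 bg'] g'g nf; have g'0 : 0 < g' := le_lt_trans b0 bg'.
have gb : 0 < g' - b by rewrite subr_gt0.
have C0 : 0 < #|{: config N q}|%:R :> R by rewrite ltr0n card_config_gt0.
set Z := \sum_(t : config N q) expR (b / N%:R * sqdev t).
have CZ : #|{: config N q}|%:R <= Z.
  rewrite -sumr_const; apply: ler_sum => t _; rewrite -expR0 ler_expR.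
  by rewrite mulr_ge0 ?sqdev_ge0 // divr_ge0.
have Z0 : 0 < Z := lt_le_trans C0 CZ.
have step s : cwp_mass b s * sqdev s <=
    N%:R / (g' - b) / Z * expR (g' / N%:R * sqdev s).
  rewrite cwp_massE -/Z mulrAC [leRHS]mulrAC ler_pM2r ?invr_gt0 //.
  have -> : g' / N%:R * sqdev s =
      b / N%:R * sqdev s + (g' - b) / N%:R * sqdev s by ring.
  rewrite expRD [leRHS]mulrCA ler_pM2l ?expR_gt0 //.
  rewrite -ler_pdivrMl ?divr_gt0 // invf_div.
  by apply: le_trans (expR_ge1Dx _); rewrite lerDr.
apply: (le_trans (ler_sum _ (fun s _ => step s))); rewrite -mulr_sumr.
have gg : 0 < g' < g by rewrite g'0.
apply: (@le_trans _ _ (N%:R / (g' - b) / Z *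
    (#|{: config N q}|%:R * expR (g * g' / (g - g'))))).
  by rewrite ler_wpM2l ?sum_expR_sqdev_le // !divr_ge0 // ltW.
set E := expR _; rewrite (_ : N%:R * (E / _) = N%:R / (g' - b) * E); last by ring.
rewrite (_ : _ * (_ * E) = N%:R / (g' - b) * E * (#|{: config N q}|%:R / Z));
  last by ring.
rewrite ler_piMr //; last by rewrite ler_pdivrMr // mul1r.
by rewrite mulr_ge0 ?expR_ge0 // divr_ge0 // ltW.
Qed.

Lemma sum_cwp_mass_dev1_le b (g g' : R) : 0 <= b < g' -> g' < g ->
  no_fixpoint q g ->
  \sum_(s : config N q) cwp_mass b s * dev1 s <=
  Num.sqrt N%:R * (expR (g * g' / (g - g')) / (g' - b) + q%:R).
Proof.
move=> bg' g'g nf; set C := _ / (g' - b).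
set r := Num.sqrt N%:R; have r0 : 0 < r by rewrite sqrtr_gt0.
have rN : N%:R = r * r by rewrite -expr2 sqr_sqrtr // ltW.
(* [r |d| <= d ^+ 2 + r ^+ 2] with [r = sqrt N] *)
have step s : r * dev1 s <= sqdev s + q%:R * N%:R.
  rewrite /dev1 /sqdev mulr_sumr mulr_natl -[X in _ *+ X](card_ord q).
  rewrite -sumr_const -big_split.
  apply: ler_sum => j _ /=; rewrite -real_normK ?num_real // rN.
  set d := `|_|; have : 0 <= (d - r) ^+ 2 + d * d + r * r.
    by rewrite !addr_ge0 ?sqr_ge0 // -expr2 sqr_ge0.
  lra.
rewrite -(ler_pM2l r0) mulr_sumr.
apply: (@le_trans _ _ (\sum_(s : config N q)
    (cwp_mass b s * sqdev s + cwp_mass b s * (q%:R * N%:R)))).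
  by apply: ler_sum => s _; rewrite mulrCA -mulrDr ler_wpM2l ?cwp_mass_ge0.
rewrite big_split /= -mulr_suml sum_cwp_mass mul1r mulrA -rN mulrDr.
by rewrite (mulrC q%:R) lerD2r sum_cwp_mass_sqdev_le.
Qed.

(** After symmetrisation, both means are taken under the product of the two laws, and the Lipschitz
    bound is applied to each pair of configurations. *)
Lemma cwp_mean_diff_le b b' (h : config N q -> R) :
  `|\sum_(s : config N q) cwp_mass b s * h s -
    \sum_(s : config N q) cwp_mass b' s * h s| <=
  lip_norm h *
    (\sum_(s : config N q) cwp_mass b s * dev1 s +
     \sum_(s : config N q) cwp_mass b' s * dev1 s).
Proof.
rewrite -!(sum_cwp_mass_symmetrise _ h).
have dbl (f f' : config N q -> R) :
    \sum_(s : config N q) cwp_mass b s * f s +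
      \sum_(s : config N q) cwp_mass b' s * f' s =
    \sum_(s : config N q) \sum_(t : config N q)
      cwp_mass b s * cwp_mass b' t * (f s + f' t).
  transitivity (\sum_(s : config N q) \sum_(t : config N q)
      (cwp_mass b s * f s * cwp_mass b' t
      + cwp_mass b s * (cwp_mass b' t * f' t))).
    under [RHS]eq_bigr => s _ do
      rewrite big_split /= -!mulr_sumr sum_cwp_mass mulr1.
    by rewrite big_split /= -mulr_suml sum_cwp_mass mul1r.
  by apply: eq_bigr => s _; apply: eq_bigr => t _; ring.
rewrite -sumrN; under [X in _ + X]eq_bigr => s _ do rewrite -mulrN.
rewrite !dbl (le_trans (ler_norm_sum _ _ _)) // mulr_sumr; apply: ler_sum => s _.
rewrite (le_trans (ler_norm_sum _ _ _)) // mulr_sumr; apply: ler_sum => t _.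
have mm : 0 <= cwp_mass b s * cwp_mass b' t by apply: mulr_ge0; exact: cwp_mass_ge0.
by rewrite normrM ger0_norm // [leRHS]mulrCA ler_wpM2l // symmetrise_dev1_lip.
Qed.

End Moments.

(** * From random variables to finite sums, and the choice of constants *)

Lemma expectation_finite_rv {R : realType} d (T : measurableType d)
    (P : probability T R) (F : finType) (X : T -> F) (m : F -> R) (h : F -> R) :
  finite_rv X -> (forall s, P [set t | X t = s] = (m s)%:E) ->
  'E_P[(fun t => h (X t))]%E = (\sum_s m s * h s)%:E.
Proof.
move=> mX Pm.
have mXs s : measurable [set t | X t = s] := mX [set s].
have -> : (fun t => h (X t)) = (fun t => \sum_s h s * \1_[set t | X t = s] t).
  apply/funext => t; rewrite (bigD1 (X t)) //= big1 ?addr0.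
    by rewrite indicE mem_set // mulr1.
  move=> s /eqP sX; rewrite indicE memNset ?mulr0 // => /esym; exact: sX.
rewrite unlock.
under eq_integral => t _ do rewrite -sumEFin.
rewrite integral_sum //; last first.
  move=> s; apply: (@integrableZl _ _ _ P setT measurableT (h s)
    (fun t => (\1_[set t | X t = s] t)%:E)).
  by apply: integrable_indic => //; rewrite setIT Pm ltry.
rewrite -sumEFin; apply: eq_bigr => s _.
under eq_integral => t _ do rewrite EFinM.
rewrite integralZl //; last by apply: integrable_indic => //; rewrite setIT Pm ltry.
rewrite integral_indic // setIT [RHS]EFinM muleC; congr (_ * _)%E.
exact: Pm.
Qed.

(** Independence over all vertices gives each configuration probability [q ^- N], the mass at
    inverse temperature 0, so one moment bound serves both laws. *)
Lemma distributed_iid_uniform_cwp0 {R : realType} d (T : measurableType d)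
    (P : probability T R) (N q : nat) (Y : T -> config N q) :
  distributed_iid_uniform P Y -> distributed_cwp P 0 Y.
Proof.
case=> mY PY indY.
have YE s : [set t | Y t = s] =
    [set t | forall v, v \in [set: 'I_N]%SET -> [set s v] (Y t v)].
  apply/seteqP; split => t /= => [-> //|Yt].
  by apply/ffunP => v; apply: Yt; rewrite inE.
have mYs s : measurable [set t | Y t = s].
  have -> : [set t | Y t = s] = \bigcap_v (fun t => Y t v) @^-1` [set s v].
    by rewrite YE; apply/seteqP; split => t Yt v _; apply: Yt; rewrite ?inE.
  by apply: fin_bigcap_measurable => [|v _]; [exact: finite_finset|exact: mY].
split => [A|s].
  have -> : Y @^-1` A = \bigcup_(s in A) [set t | Y t = s].
    by apply/seteqP; split => t /=; [exists (Y t)|case=> s As /= ->].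
  by apply: fin_bigcup_measurable => //; exact: finite_finset.
rewrite YE; apply: (etrans (indY [set: 'I_N]%SET (fun v => [set s v]))).
rewrite (eq_bigr (fun=> (q%:R^-1)%:E)) => [|v _]; last exact: PY.
rewrite -(big_morph EFin EFinM erefl) prodr_const cardsT card_ord.
by rewrite cwp_mass0 card_ffun !card_ord natrX exprVn.
Qed.

Theorem theorem1p3 (R : realType) (q : nat) (beta : R) :
  (3 <= q)%N -> 0 <= beta -> beta < beta_s q ->
  exists2 theta : R, 0 < theta &
    forall (N : nat) (h : config N q -> R), (1 <= N)%N ->
    forall (dX : measure_display) (TX : measurableType dX)
           (PX : probability TX R) (X : TX -> config N q)
           (dY : measure_display) (TY : measurableType dY)
           (PY : probability TY R) (Y : TY -> config N q),
      distributed_cwp PX beta X -> distributed_iid_uniform PY Y ->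
      (`| 'E_PX[(fun t => h (X t))] - 'E_PY[(fun t => h (Y t))] |
       <= (lip_norm h * theta * Num.sqrt N%:R)%:E)%E.
Proof.
move=> q3 beta0 beta_lt; have q2 : (2 <= q)%N := ltnW q3.
have [g [_ nf] beta_g] : exists2 g : R, 0 <= g /\ no_fixpoint q g & beta < g.
  (* An empty set would give [beta_s] the default value 0, contradicting [0 <= beta < beta_s q]. *)
  apply: (sup_gt _ beta_lt); apply/set0P/eqP => E0.
  by move: beta_lt; rewrite /beta_s E0 sup0 ltNge beta0.
(* The midpoint leaves room on both sides: below [g] for the exponential moment, above [beta] for
   the passage to the Gibbs measure. *)
pose g' := (beta + g) / 2.
have beta_g' : beta < g' by rewrite /g'; lra.
have g'g : g' < g by rewrite /g'; lra.
pose C b : R := expR (g * g' / (g - g')) / (g' - b) + q%:R.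
have C0 b : 0 <= b < g' -> 0 < C b.
  by move=> /andP[_ bg']; rewrite addr_gt0 ?divr_gt0 ?expR_gt0 ?subr_gt0 // ltr0n ltnW.
have beta_int : 0 <= beta < g' by rewrite beta0.
have zero_int : 0 <= (0 : R) < g' by rewrite lexx (le_lt_trans beta0).
exists (C beta + C 0); first by rewrite addr_gt0 ?C0.
move=> N h N0 dX TX PX X dY TY PY Y [mX massX] /distributed_iid_uniform_cwp0[mY massY].
rewrite (expectation_finite_rv h mX massX) (expectation_finite_rv h mY massY).
rewrite -EFinB abse_EFin lee_fin (le_trans (cwp_mean_diff_le q2 _ _ h)) //.
rewrite -mulrA ler_wpM2l ?lip_norm_ge0 // mulrC mulrDr.
by apply: lerD; exact: sum_cwp_mass_dev1_le.
Qed.
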